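(* $$\int_0^1 \bigl(S(x)\bigr)^n\,dx=\begin{cases}\displaystyle\prod_{i=1}^{k}(2i-1), & n=2k,\ k\ge 1,\\[2mm] 0, & n=2k+1,\ k\ge 0.\end{cases}$$
   Context: $N:\mathbb{R}\to(0,1)$ is $N(x)=\frac{1}{\sqrt{2\pi}}\int_{-\infty}^{x}e^{-t^2/2}\,dt$, and $S:(0,1)\to\mathbb{R}$ denotes its inverse. $S^n$ denotes the $n$-th power of $S$ (not a derivative or iterate). *)

(* Defs.v *)
From mathcomp Require Import all_boot all_order all_algebra.
From mathcomp Require Import all_classical all_reals all_analysis.
Set Implicit Arguments. Unset Strict Implicit. Unset Printing Implicit Defensive.
Import Order.TTheory GRing.Theory Num.Theory.
Import numFieldNormedType.Exports.
Local Open Scope classical_set_scope.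
Local Open Scope ring_scope.

Definition Nfun {R : realType} (x : R) : R :=
  (Num.sqrt (2 * pi))^-1 *
  \int[lebesgue_measure]_(t in `]-oo, x]) expR (- (t ^+ 2 / 2)).

(* [Nfun] is a bijection from [R] onto the open interval (0,1); [Sfun] is its inverse
   on (0,1), with a meaningless default value outside. *)
Definition Sfun {R : realType} : R -> R := pinv [set: R] Nfun.

(* Main.v *)
(* Substituting x = Nfun t turns the integral into the n-th moment of the
   standard normal law, with density phi. Since phi'(t) = - t phi(t), the
   function t^n phi(t), which vanishes at both infinities, is an antiderivative
   of n t^(n-1) phi(t) - t^(n+1) phi(t). Hence the moments satisfy
   M_(n+1) = n M_(n-1), starting from M_0 = 1 and M_1 = 0. *)
From HB Require Import structures.
Require Import Defs.
From mathcomp Require Import all_boot all_order all_algebra.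
From mathcomp Require Import all_classical all_reals all_analysis.
From mathcomp Require Import measurable_realfun.
From mathcomp Require Import ring lra.
Set Implicit Arguments. Unset Strict Implicit. Unset Printing Implicit Defensive.
Import Order.TTheory GRing.Theory Num.Theory.
Import numFieldNormedType.Exports.
Local Open Scope classical_set_scope.
Local Open Scope ring_scope.

(** * Continuity and strict monotonicity from the derivative *)

Lemma is_derive_continuous {R : realType} (F f : R -> R) :
  (forall x : R, is_derive x 1 F (f x)) -> continuous F.
Proof.
by move=> dF x; apply/differentiable_continuous/derivable1_diffP; case: (dF x).
Qed.

Lemma is_derive_gt0_incr {R : realType} (F f : R -> R) :
  (forall x : R, is_derive x 1 F (f x)) -> (forall x, 0 < f x) ->
  {homo F : x y / x < y}.
Proof.
move=> dF f_gt0 x y xy; apply: (@gtr0_derive1_lt_cc _ F x y) => //.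
- by move=> z _; rewrite derive1E derive_val.
- exact: continuous_subspaceT (is_derive_continuous dF).
- by rewrite in_itv/= lexx ltW.
- by rewrite in_itv/= lexx ltW.
Qed.

(** * Change of variables along the inverse of an increasing bijection from the line onto an open
    interval *)

Section inverse_substitution.
Context {R : realType}.
Local Notation mu := (@lebesgue_measure R).
Variables (F f G : R -> R) (a b : R).
Hypothesis dF : forall x : R, is_derive x 1 F (f x).
Hypothesis cf : continuous f.
Hypothesis f_gt0 : forall x, 0 < f x.
Hypothesis FK : cancel F G.
Hypothesis GK : {in `]a, b[, cancel G F}.
Hypothesis Fab : forall x, F x \in `]a, b[.

Let derivF : derive1 F = f.
Proof. by apply/funext => x; rewrite derive1E; apply: derive_val. Qed.

Let continuousF : continuous F.
Proof. exact: is_derive_continuous dF. Qed.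

Let F_incr : {homo F : x y / x < y}.
Proof. exact: is_derive_gt0_incr dF f_gt0. Qed.

(** Each [y] of the interval is [F (G y)], and a left inverse of a continuous real function is
    continuous at its values. *)
Lemma continuous_inverse : {in `]a, b[, continuous G}.
Proof.
move=> y yab; rewrite -(GK yab).
apply: (@nbhs_singleton _ (F (G y)) (fun z => {for z, continuous G})).
apply: near_can_continuous; apply: filterE; [exact: FK|exact: continuousF].
Qed.

Lemma measurable_comp_inverse (h : R -> R) : continuous h ->
  measurable_fun `]a, b[ (h \o G).
Proof.
move=> ch; apply: open_continuous_measurable_fun => //.
move=> y /set_mem yab; apply: continuous_comp; last exact: ch.
exact: continuous_inverse.
Qed.

(** Exhaust the line by the compact intervals [A m] and []a, b[] by their images [B m]. Substitution
    on compact intervals equates the integrals over [B m] and [A m], and monotone convergence passes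
    to the limit on both sides. *)
Lemma ge0_integral_comp_inverse (h : R -> R) :
  continuous h -> (forall x, 0 <= h x) ->
  (\int[mu]_(y in `]a, b[) (h (G y))%:E = \int[mu]_x (h x * f x)%:E)%E.
Proof.
move=> ch h_ge0.
pose A m : set R := `[- m%:R, m%:R]%classic.
pose B m : set R := `[F (- m%:R), F m%:R]%classic.
have UA : \bigcup_m A m = setT.
  apply/seteqP; split=> // x _; exists (Num.bound `|x|) => //=.
  rewrite /A/= in_itv/= -ler_norml; apply: ltW; exact: archi_boundP.
have UB : \bigcup_m B m = `]a, b[%classic.
  apply/seteqP; split=> [y [m _]|y yab].
    rewrite /B/= !in_itv/= => /andP[y1 y2].
    have := Fab (- m%:R); have := Fab m%:R; rewrite !in_itv/=.
    move=> /andP[_ Fb] /andP[Fa _].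
    by rewrite (lt_le_trans Fa)// (le_lt_trans y2).
  (* If [G y] lies in [A m], monotonicity of [F] puts [y = F (G y)] in [B m]. *)
  have : (\bigcup_m A m) (G y) by rewrite UA.
  move=> [m _]; rewrite /A/= in_itv/= => /andP[Gl Gr]; exists m => //=.
  by rewrite /B/= in_itv/= -(GK yab) !(ltW_homo F_incr).
have nA : nondecreasing_seq A.
  move=> i j ij; apply/subsetPset/subset_itv; rewrite bnd_simp ?lerN2 ler_nat//.
have nB : nondecreasing_seq B.
  move=> i j ij; apply/subsetPset/subset_itv;
    rewrite bnd_simp (ltW_homo F_incr)//.
    by rewrite lerN2 ler_nat.
  by rewrite ler_nat.
have mhf : measurable_fun [set: R] (fun x => (h x * f x)%:E).
  apply/measurable_EFinP; apply: continuous_measurable_fun => x.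
  by apply: continuousM; [exact: ch|exact: cf].
have BD m : B m `<=` `]a, b[ by rewrite -UB; exact: bigcup_sup.
have mhG : measurable_fun `]a, b[ (fun y => (h (G y))%:E).
  apply/measurable_EFinP; exact: measurable_comp_inverse.
have cA : (\int[mu]_(x in A m) (h x * f x)%:E @[m --> \oo]
    --> \int[mu]_x (h x * f x)%:E)%E.
  rewrite -UA; apply: ge0_nondecreasing_set_cvg_integral => //.
  - by move=> m; exact: measurable_itv.
  - by move=> m; exact: measurable_funTS.
  - by move=> m x _; rewrite lee_fin mulr_ge0// ltW.
have cB : (\int[mu]_(y in B m) (h (G y))%:E @[m --> \oo]
    --> \int[mu]_(y in `]a, b[) (h (G y))%:E)%E.
  rewrite -UB; apply: ge0_nondecreasing_set_cvg_integral => //.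
  - by move=> m; exact: measurable_itv.
  - by move=> m; apply: (measurable_funS _ (BD m) mhG).
  - by move=> m x _; rewrite lee_fin.
apply: cvg_unique cB _ => //.
move: cA; apply: cvg_trans; apply: near_eq_cvg; apply: nearW => m.
(* The substitution is [y = F x], applied to [h \o G], so that [h (G (F x))] collapses to [h x]. *)
rewrite /B (@integration_by_substitution_increasing _ F (h \o G))//.
- by apply: eq_integral => x _; rewrite derivF /= !fctE/= FK.
- by rewrite -subr_ge0 opprK addr_ge0.
- by move=> x y _ _; exact: F_incr.
- by rewrite derivF => x _; exact: cf.
- rewrite derivF; apply: (cvgP (f (- m%:R))).
  by apply: cvg_at_right_filter; exact: cf.
- rewrite derivF; apply: (cvgP (f m%:R)).
  by apply: cvg_at_left_filter; exact: cf.
- split.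
  + by move=> x _; case: (dF x).
  + by apply: cvg_at_right_filter; exact: continuousF.
  + by apply: cvg_at_left_filter; exact: continuousF.
- apply: continuous_in_subspaceT => y /set_mem yB.
  apply: continuous_comp; last exact: ch.
  by apply: continuous_inverse; exact: BD yB.
Qed.

(** Positive and negative parts of [h] are continuous and nonnegative, so the previous case applies
    to each; since [f] is positive, it can be moved inside the maximum with 0. *)
Lemma integral_comp_inverse (h : R -> R) : continuous h ->
  (\int[mu]_(y in `]a, b[) (h (G y))%:E = \int[mu]_x (h x * f x)%:E)%E.
Proof.
move=> ch; rewrite integralE [RHS]integralE; congr (_ - _)%E.
- under eq_integral do rewrite funeposE -EFin_max.
  rewrite (@ge0_integral_comp_inverse (fun x => Num.max (h x) 0)).
  + apply: eq_integral => x _.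
    by rewrite funeposE -EFin_max maxr_pMl ?mul0r// ltW.
  + by apply: (max_fun_continuous ch) => x; exact: cvg_cst.
  + by move=> x; rewrite le_max lexx orbT.
- under eq_integral do rewrite funenegE -EFin_max.
  rewrite (@ge0_integral_comp_inverse (fun x => Num.max (- h x) 0)).
  + apply: eq_integral => x _.
    by rewrite funenegE -EFin_max maxr_pMl ?mul0r ?mulNr// ltW.
  + apply: max_fun_continuous => x; last exact: cvg_cst.
    by apply: continuousN; exact: ch.
  + by move=> x; rewrite le_max lexx orbT.
Qed.

(** The nonnegative case for the absolute value of [h] transports finiteness of the integral. *)
Lemma integrable_comp_inverse (h : R -> R) : continuous h ->
  mu.-integrable setT (fun x => (h x * f x)%:E) ->
  mu.-integrable `]a, b[ (fun y => (h (G y))%:E).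
Proof.
move=> ch /integrableP[_ hfoo]; apply/integrableP; split.
  by apply/measurable_EFinP; exact: measurable_comp_inverse.
under eq_integral do rewrite abse_EFin.
rewrite (@ge0_integral_comp_inverse (fun x => `|h x|))//.
  under eq_integral do rewrite -[f _]gtr0_norm// -normrM -abse_EFin.
  exact: hfoo.
by move=> x; apply: continuous_comp; [exact: ch|exact: norm_continuous].
Qed.

End inverse_substitution.

(** * The standard normal distribution function and its inverse *)

Section standard_normal_cdf.
Context {R : realType}.
Local Notation mu := (@lebesgue_measure R).
Local Notation phi := (@normal_pdf R 0 1).

Lemma standard_normal_pdfE (x : R) :
  phi x = (Num.sqrt (2 * pi))^-1 * expR (- (x ^+ 2 / 2)).
Proof.
rewrite normal_pdfE ?oner_eq0//; congr (_ * _).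
  by rewrite /normal_peak expr1n mul1r mulr_natl.
by rewrite /normal_fun subr0 expr1n mulNr.
Qed.

Lemma standard_normal_pdf_gt0 (x : R) : 0 < phi x.
Proof.
rewrite standard_normal_pdfE mulr_gt0 ?expR_gt0//.
by rewrite invr_gt0 sqrtr_gt0 mulr_gt0 ?pi_gt0.
Qed.

Lemma Nfun_normal_pdf (x : R) : Nfun x = \int[mu]_(t in `]-oo, x]) phi t.
Proof.
have peak_neq0 : Num.sqrt (2 * pi) != 0 :> R.
  by rewrite gt_eqF// sqrtr_gt0 mulr_gt0 ?pi_gt0.
under [RHS]eq_Rintegral do rewrite standard_normal_pdfE.
rewrite RintegralZl//.
(* Pulling the constant out requires integrability of the bare exponential, which is a constant
   multiple of [phi]. *)
rewrite [X in _.-integrable _ X](_ : _ =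
    (fun t => (Num.sqrt (2 * pi))%:E * (phi t)%:E)%E); last first.
  by apply/funext => t; rewrite -EFinM standard_normal_pdfE mulrA divff// mul1r.
apply: integrableZl => //.
by apply: (integrableS measurableT) => //; exact: integrable_normal_pdf.
Qed.

Lemma is_derive_Nfun (x : R) : is_derive x 1 Nfun (phi x).
Proof.
have -> : Nfun = (fun x : R => \int[mu]_(t in `]-oo, x]) phi t).
  by apply/funext => y; rewrite Nfun_normal_pdf.
(* The fundamental theorem needs integrability up to a point strictly beyond [x]; [x + 1] is one
   choice. *)
have xx1 : x < x + 1 by rewrite ltrDl.
have phi_int : mu.-integrable `]-oo, x + 1] (EFin \o phi).
  by apply: (integrableS measurableT) => //; exact: integrable_normal_pdf.
have [||dN NE] := continuous_FTC1 xx1 phi_int.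
- exact: ltNyr.
- by apply: continuous_normal_pdf; rewrite oner_eq0.
by apply: DeriveDef => //; rewrite -derive1E.
Qed.

Lemma Nfun_incr : {homo @Nfun R : x y / x < y}.
Proof. exact: is_derive_gt0_incr is_derive_Nfun standard_normal_pdf_gt0. Qed.

(** The identity, viewed as a random variable under the normal law, has [Nfun] as its distribution
    function; the limits at both infinities then come from the general theory. *)
Let idTR : measurableTypeR R -> R := idfun.

#[local] HB.instance Definition _ :=
  @isMeasurableFun.Build _ _ _ _ idTR (@measurable_id _ _ setT).

Let P : probability (measurableTypeR R) R := normal_prob 0 1.

Lemma Nfun_cdf : @Nfun R = fine \o cdf (idTR : {RV P >-> R}).
Proof. by apply/funext => x; rewrite Nfun_normal_pdf. Qed.

Lemma cvg_Nfun_Ny : Nfun x @[x --> -oo] --> (0 : R).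
Proof. rewrite Nfun_cdf; apply: fine_cvg; exact: cvg_cdfNy0. Qed.

Lemma cvg_Nfun_y : Nfun x @[x --> +oo] --> (1 : R).
Proof. rewrite Nfun_cdf; apply: fine_cvg; exact: cvg_cdfy1. Qed.

Lemma Nfun_itv (x : R) : Nfun x \in `]0, 1[.
Proof.
have N_ge0 z : 0 <= Nfun z :> R by rewrite Nfun_cdf/= fine_ge0.
have N_le1 z : Nfun z <= 1 :> R.
  rewrite Nfun_cdf -lee_fin fineK; last by rewrite fin_num_measure.
  exact: cdf_le1.
(* Strict bounds at [x] follow from the weak ones at [x - 1] and [x + 1] by strict monotonicity. *)
rewrite in_itv/= (le_lt_trans (N_ge0 (x - 1))) ?Nfun_incr ?gtrBl//=.
by rewrite (lt_le_trans _ (N_le1 (x + 1))) ?Nfun_incr ?ltrDl.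
Qed.

(** The limits 0 and 1 give points where [Nfun] is below and above [y]; the intermediate value
    theorem does the rest. *)
Lemma Nfun_surj (y : R) : y \in `]0, 1[ -> exists x, Nfun x = y.
Proof.
rewrite in_itv/= => /andP[y_gt0 y_lt1].
have [a Na] : exists a : R, Nfun a < y.
  have /cvgr_lt/(_ y y_gt0) := cvg_Nfun_Ny.
  by move=> /filter_ex.
have [b Nb] : exists b : R, y < Nfun b.
  have /cvgr_gt/(_ y y_lt1) := cvg_Nfun_y.
  by move=> /filter_ex.
have ab : a <= b.
  rewrite leNgt; apply/negP => /Nfun_incr ba.
  by have := lt_trans (lt_trans Na Nb) ba; rewrite ltxx.
have [c _ Nc] : exists2 c, c \in `[a, b] & Nfun c = y.
  apply: IVT => //.
    exact: continuous_subspaceT (is_derive_continuous is_derive_Nfun).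
  by rewrite ge_min le_max (ltW Na) (ltW Nb) orbT.
by exists c.
Qed.

Lemma NfunK : cancel (@Nfun R) Sfun.
Proof.
move=> x; apply: pinvKV; rewrite ?inE// => u v _ _ uv.
by case: (ltgtP u v) => // /Nfun_incr; rewrite uv ltxx.
Qed.

Lemma SfunK : {in `]0, 1[, cancel Sfun (@Nfun R)}.
Proof. by move=> y /Nfun_surj[x <-]; rewrite NfunK. Qed.

End standard_normal_cdf.

(** * Integrating a derivative over the whole line, and growth estimates *)

(** Truncate [f] to [[- m, m]]: the truncated integrals are [F m - F (- m)], and they converge to
    the full integral by dominated convergence with dominating function [|f|]. *)
Lemma integralT_FTC2 {R : realType} (F f : R -> R) (l r : R) :
  (forall x : R, is_derive x 1 F (f x)) -> continuous f ->
  (@lebesgue_measure R).-integrable setT (EFin \o f) ->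
  F x @[x --> -oo] --> l -> F x @[x --> +oo] --> r ->
  (\int[@lebesgue_measure R]_x (f x)%:E = (r - l)%:E)%E.
Proof.
move=> dF cf intf Fl Fr; have mf : measurable_fun setT f.
  exact: continuous_measurable_fun.
pose A m : set R := `[- m%:R, m%:R]%classic.
have : (\int[@lebesgue_measure R]_x ((EFin \o f) \_ (A m)) x @[m --> \oo]
    --> \int[@lebesgue_measure R]_x (f x)%:E)%E.
  have mfA m : measurable_fun setT ((EFin \o f) \_ (A m)).
    apply/(measurable_restrictT _ _).1; first exact: measurable_itv.
    by apply: measurable_funTS; exact/measurable_EFinP.
  have fA x : ((EFin \o f) \_ (A m)) x @[m --> \oo] --> (f x)%:E.
    (* Once [m] exceeds [|x|], the truncation no longer affects the value at [x]. *)
    apply: cvg_near_cst; exists (Num.bound `|x|) => // m /= xm.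
    rewrite patchT// inE /A/= in_itv/= -ler_norml.
    by rewrite (le_trans (ltW (archi_boundP _)))// ler_nat.
  have fA_le x m : (`|((EFin \o f) \_ (A m)) x| <= `|(f x)%:E|)%E.
    by rewrite patchE; case: ifPn => _ /=; rewrite ?normr0 lee_fin.
  have [] := @dominated_convergence _ _ R (@lebesgue_measure R) setT measurableT
    (fun m => (EFin \o f) \_ (A m)) (EFin \o f) (abse \o (EFin \o f)).
  - exact: mfA.
  - exact/measurable_EFinP.
  - by apply: aeW => x _; exact: fA.
  - exact: integrable_abse.
  - by apply: aeW => x m _; exact: fA_le.
  - by [].
move=> intA; apply: cvg_unique intA _ => //.
have FrB : F m%:R - F (- m%:R) @[m --> \oo] --> r - l.
  apply: cvgB; first exact: cvg_comp cvgr_idn Fr.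
  by move/cvgNy_compNP: Fl; apply: cvg_comp; exact: cvgr_idn.
have /cvg_EFin : \forall m \near \oo, (F m%:R - F (- m%:R))%:E \is a fin_num.
  by apply: nearW.
move=> /(_ _ FrB); apply: cvg_trans; apply: near_eq_cvg; near=> m.
(* The fundamental theorem is used on a nondegenerate interval, which excludes [m = 0]. *)
have m0 : 0 < m%:R :> R by rewrite ltr0n; near: m; exact: nbhs_infty_gt.
rewrite -integral_mkcond/= (@continuous_FTC2 _ f F).
- by rewrite EFinB.
- by rewrite (lt_trans _ m0)// oppr_lt0.
- exact: continuous_subspaceT.
- have cF := is_derive_continuous dF.
  split.
  + by move=> x _; case: (dF x).
  + by apply: cvg_at_right_filter; exact: cF.
  + by apply: cvg_at_left_filter; exact: cF.
- by move=> x _; rewrite derive1E; apply: derive_val.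
Unshelve. all: by end_near. Qed.

(** For positive [x] the bound reads [|f x| <= C / x], which is at most [e] as soon as
    [x >= C / e]. *)
Lemma normM_bounded_cvgr0 {R : realType} (f : R -> R) (C : R) :
  (forall x, `|x| * `|f x| <= C) -> f x @[x --> +oo] --> 0.
Proof.
move=> fC; apply/cvgr0Pnorm_le => e e0; near=> x.
have x0 : 0 < x by near: x; exact: nbhs_pinfty_gt.
rewrite -(ler_pM2l x0) -{1}(gtr0_norm x0) (le_trans (fC x))//.
rewrite -ler_pdivrMr//; near: x; apply: nbhs_pinfty_ge; exact: num_real.
Unshelve. all: by end_near. Qed.

(** With [y = x ^+ 2 / 4], one term of the exponential series gives [y ^+ n <= n! * expR y], while
    [|x| ^+ n] is at most 1 plus its own square, that is [1 + 4 ^+ n * y ^+ n]. As [1 <= expR y],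
    the two bounds add up to the constant. *)
Lemma exprn_le_expR_sqr {R : realType} (n : nat) : exists2 C : R, 0 <= C &
  forall x, `|x| ^+ n <= C * expR (x ^+ 2 / 4).
Proof.
exists (1 + 4 ^+ n * n`!%:R); first by rewrite addr_ge0// mulr_ge0// exprn_ge0.
move=> x; set y := x ^+ 2 / 4.
have y0 : 0 <= y by rewrite mulr_ge0// sqr_ge0.
have yn : y ^+ n <= n`!%:R * expR y.
  case: n => [|n].
    by rewrite expr0 fact0 mul1r -[leLHS]expR0 ler_expR.
  rewrite -ler_pdivrMl ?ltr0n ?fact_gt0// mulrC.
  by apply: le_trans (expR_ge1Dxn n y0); rewrite lerDr.
have xn : `|x| ^+ n <= 1 + 4 ^+ n * y ^+ n.
  rewrite -exprMn /y mulrC divfK// -(real_normK (num_real x)) exprAC.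
  by nra.
rewrite (le_trans xn)// mulrDl mul1r lerD//.
  by rewrite -[leLHS]expR0 ler_expR.
by rewrite -mulrA ler_wpM2l// exprn_ge0.
Qed.

(** * Moments of the standard normal law *)

Section standard_normal_moments.
Context {R : realType}.
Local Notation mu := (@lebesgue_measure R).
Local Notation phi := (@normal_pdf R 0 1).

(* The density with standard deviation sqrt 2 is proportional to
   exp (- x^2 / 4), hence dominates x^n exp (- x^2 / 2) up to a constant. *)
Lemma exprn_normal_pdf_le (n : nat) : exists C : R, forall x : R,
  `|x ^+ n * phi x| <= C * normal_pdf 0 (Num.sqrt 2) x.
Proof.
have [C C0 xC] := @exprn_le_expR_sqr R n.
have s0 : Num.sqrt 2 != 0 :> R by rewrite gt_eqF// sqrtr_gt0.
have p0 := normal_peak_gt0 s0.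
exists (C * (Num.sqrt (2 * pi))^-1 / normal_peak (Num.sqrt 2)) => x.
rewrite normrM (ger0_norm (normal_pdf_ge0 _ _ _)) normrX standard_normal_pdfE.
rewrite normal_pdfE// [leRHS]mulrA divfK ?gt_eqF//.
rewrite -[leRHS]mulrA mulrCA [leRHS]mulrCA.
rewrite ler_wpM2l ?invr_ge0//.
rewrite (le_trans (ler_wpM2r (expR_ge0 _) (xC x)))// -mulrA ler_wpM2l//.
rewrite -expRD ler_expR /normal_fun subr0 sqr_sqrtr// mulNr -mulr_natr.
by rewrite le_eqVlt; apply/orP; left; apply/eqP; field.
Qed.

Lemma integrable_exprn_normal_pdf (n : nat) :
  mu.-integrable setT (fun x : R => (x ^+ n * phi x)%:E).
Proof.
have [C xC] := exprn_normal_pdf_le n.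
have int2 := integrableZl measurableT C (integrable_normal_pdf 0 (Num.sqrt 2)).
apply: le_integrable int2 => //.
  apply/measurable_EFinP; apply: measurable_funM; first exact: exprn_measurable.
  exact: measurable_normal_pdf.
by move=> x _; rewrite -EFinM !abse_EFin lee_fin (le_trans (xC x))// ler_norm.
Qed.

Lemma continuous_exprn_normal_pdf (n : nat) :
  continuous (fun x : R => x ^+ n * phi x).
Proof.
move=> x; apply: cvgM; first exact: exprn_continuous.
by apply: continuous_normal_pdf; rewrite oner_eq0.
Qed.

(** The domination for exponent [n.+1] bounds [|x| * |x ^+ n * phi x|], since a normal density is
    bounded by its peak. The limit at minus infinity follows by reflection, the bound being
    insensitive to the sign of [x]. *)
Lemma cvg_exprn_normal_pdf (n : nat) :
  x ^+ n * phi x @[x --> +oo] --> (0 : R) /\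
  x ^+ n * phi x @[x --> -oo] --> (0 : R).
Proof.
have [C xC] := exprn_normal_pdf_le n.+1.
have C0 (x : R) :
    `|x| * `|x ^+ n * phi x| <= `|C| * normal_peak (Num.sqrt 2).
  rewrite -normrM mulrA -exprS (le_trans (xC x))//.
  rewrite (le_trans (ler_norm _))// normrM (ger0_norm (normal_pdf_ge0 _ _ _)).
  by rewrite ler_wpM2l// normal_pdf_ub// gt_eqF// sqrtr_gt0.
split; first exact: normM_bounded_cvgr0 C0.
apply/cvgNy_compNP; apply: normM_bounded_cvgr0 => x /=.
by rewrite -(normrN x); exact: C0.
Qed.

Lemma is_derive_standard_normal_pdf (x : R) :
  is_derive x 1 phi (- x * phi x).
Proof.
have -> : phi = (fun x => (Num.sqrt (2 * pi))^-1 * expR (- (x ^+ 2 / 2))).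
  by apply/funext => y; rewrite standard_normal_pdfE.
apply: is_derive_eq.
by rewrite /GRing.scale/=; set c := (Num.sqrt _)^-1; field.
Qed.

(** The derivative of [x ^+ n * phi x] integrates to 0 because the boundary limits vanish. For
    [n = 0] the truncated [n.-1] is harmless: its coefficient is 0, so the formula says that the
    mean is 0. *)
Lemma integral_exprn_normal_pdf_rec (n : nat) :
  (\int[mu]_x (x ^+ n.+1 * phi x)%:E =
   n%:R%:E * \int[mu]_x (x ^+ n.-1 * phi x)%:E)%E.
Proof.
have dF (x : R) : is_derive x 1 (fun x => x ^+ n * phi x)
    (n%:R * (x ^+ n.-1 * phi x) - x ^+ n.+1 * phi x).
  have dphi := is_derive_standard_normal_pdf x.
  have -> : (fun x : R => x ^+ n * phi x) = (id ^+ n) * phi.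
    by apply/funext => y; rewrite !fctE.
  apply: is_derive_eq; rewrite /GRing.scale/= fctE exprS.
  by ring.
have intn := integrableZl measurableT n%:R (integrable_exprn_normal_pdf n.-1).
have intSn := integrable_exprn_normal_pdf n.+1.
have [Fy FNy] := cvg_exprn_normal_pdf n.
have := integralT_FTC2 dF _ _ FNy Fy; rewrite subrr => F0.
have : (\int[mu]_x (n%:R * (x ^+ n.-1 * phi x) - x ^+ n.+1 * phi x)%:E = 0)%E.
  apply: F0.
    move=> x; apply: cvgB; last exact: continuous_exprn_normal_pdf.
    by apply: cvgM; [exact: cvg_cst|exact: continuous_exprn_normal_pdf].
  by apply: eq_integrable (integrableB measurableT intn intSn).
rewrite (_ : \int[mu]_x _ = n%:R%:E * \int[mu]_x (x ^+ n.-1 * phi x)%:E -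
    \int[mu]_x (x ^+ n.+1 * phi x)%:E)%E; last first.
  by rewrite -integralZl// -?integralB//; exact: integrable_exprn_normal_pdf.
(* Both moments are finite, so the vanishing difference can be read in the reals, where it yields
   equality. *)
have intp := integrable_exprn_normal_pdf n.-1.
rewrite -(fineK (integrable_fin_num measurableT intSn)).
rewrite -(fineK (integrable_fin_num measurableT intp)).
by rewrite -EFinM -EFinB => -[/eqP]; rewrite subr_eq0 => /eqP ->.
Qed.

Lemma integral_exprn_normal_pdf_odd (k : nat) :
  (\int[mu]_x (x ^+ (2 * k + 1) * phi x)%:E = 0)%E.
Proof.
elim: k => [|k IHk]; first by rewrite integral_exprn_normal_pdf_rec mul0e.
rewrite mulnS -addnA add2n.
by rewrite integral_exprn_normal_pdf_rec/= IHk mule0.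
Qed.

Lemma integral_exprn_normal_pdf_even (k : nat) :
  (\int[mu]_x (x ^+ (2 * k) * phi x)%:E =
   (\prod_(1 <= i < k.+1) (2 * i%:R - 1 : R))%:E)%E.
Proof.
elim: k => [|k IHk].
  (* For [k = 0] the empty product is the total mass 1 of the density. *)
  rewrite big_geq//; under eq_integral do rewrite expr0 mul1r.
  exact: integral_normal_pdf.
rewrite mulnS add2n integral_exprn_normal_pdf_rec/= IHk [in RHS]big_nat_recr//=.
rewrite -EFinM mulrC; congr (_ * _)%:E.
(* The recurrence factor [2 * k + 1] is the new factor [2 * i - 1] at [i = k + 1]. *)
by rewrite -natr1 natrM; ring.
Qed.

End standard_normal_moments.

(** Integrability is asserted next to each value because the integral is extended-real and is
    defined for nonintegrable functions too. The open interval keeps out the endpoints, where [Sfun]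
    takes default values. *)
Theorem proposition19 (R : realType) (n : nat) :
  (forall k : nat, (1 <= k)%N -> n = (2 * k)%N ->
    (@lebesgue_measure R).-integrable `]0, 1[ (fun x => (Sfun x ^+ n)%:E) /\
    (\int[@lebesgue_measure R]_(x in `]0%R, 1%R[) (Sfun x ^+ n)%:E =
       (\prod_(1 <= i < k.+1) (2 * i%:R - 1 : R))%:E)%E) /\
  (forall k : nat, n = (2 * k + 1)%N ->
    (@lebesgue_measure R).-integrable `]0, 1[ (fun x => (Sfun x ^+ n)%:E) /\
    (\int[@lebesgue_measure R]_(x in `]0%R, 1%R[) (Sfun x ^+ n)%:E = 0)%E).
Proof.
have cphi := @continuous_normal_pdf R 0 1 (oner_neq0 R).
have cX m : continuous (fun x : R => x ^+ m) by exact: exprn_continuous.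
have intS m : (@lebesgue_measure R).-integrable `]0, 1[
    (fun x => (Sfun x ^+ m)%:E).
  (* Substitution with [F = Nfun], [G = Sfun], the normal density as [f], and the power function as
     [h]. *)
  apply: (integrable_comp_inverse is_derive_Nfun cphi
    standard_normal_pdf_gt0 NfunK SfunK Nfun_itv (cX m)).
  exact: integrable_exprn_normal_pdf.
have SE m : (\int[@lebesgue_measure R]_(x in `]0%R, 1%R[) (Sfun x ^+ m)%:E =
    \int[@lebesgue_measure R]_x (x ^+ m * normal_pdf 0 1 x)%:E)%E.
  exact: (integral_comp_inverse is_derive_Nfun cphi
    standard_normal_pdf_gt0 NfunK SfunK Nfun_itv (cX m)).
split=> [k _ ->|k ->]; (split; first exact: intS); rewrite SE.
  exact: integral_exprn_normal_pdf_even.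
exact: integral_exprn_normal_pdf_odd.
Qed.
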